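(* Let $A=\Delta_h^2\in\mathbb{R}^{N_x\times N_x}$, where $\Delta_h$ is the one-dimensional discrete Neumann Laplacian, and let $A=PDP^{-1}$ with $D$ diagonal. Let $T>0$, let $\mathbf{u}$ solve $\dot{\mathbf{u}}(t)+A\mathbf{u}(t)=0$ on $(0,T]$, $\mathbf{u}(0)=\mathbf{u}_0$, and let $\mathbf{u}^k$ be the $k$-th iterate ($k\ge1$, starting from an initial guess $\mathbf{u}^0$) of the PinT algorithm $$\dot{\mathbf{u}}^k(t)+A\mathbf{u}^k(t)=0,\qquad \mathbf{u}^k(0)=\alpha\mathbf{u}^k(T)-\alpha\mathbf{u}^{k-1}(T)+\mathbf{u}_0,$$ with $|\alpha|<1/2$. Then the error $\mathbf{e}^k(t)=\mathbf{u}^k(t)-\mathbf{u}(t)$ satisfies $$\| P^{-1}\mathbf{e}^k \|_{L^{\infty}(0, T;L^{\infty}(\Omega))}\leq \left(\frac{|\alpha|}{1-|\alpha|} \right) ^k \| P^{-1}\mathbf{e}^0\|_{L^{\infty}(0, T;L^{\infty}(\Omega))}.$$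
   Context: $\Delta_h\in\mathbb{R}^{N_x\times N_x}$ is the central finite difference Laplacian on an interval $\Omega$ with $N_x$ equidistant grid points, mesh size $h$, and homogeneous Neumann conditions: $\Delta_h=h^{-2}B$, where $B$ is tridiagonal with all diagonal entries $-2$, all sub- and superdiagonal entries $1$, except that $B_{1,2}=2$ and $B_{N_x,N_x-1}=2$. The eigenvalues of $\Delta_h$ are $\lambda_p=\frac{2}{h^2}\{\cos(\frac{(p-1)\pi}{N_x-1})-1\}$, $p=1,\dots,N_x$; $D=\mathrm{diag}(\lambda_1^2,\dots,\lambda_{N_x}^2)$ and the columns of $P$ are corresponding eigenvectors of $A$. For a vector function $\mathbf{v}:[0,T]\to\mathbb{R}^{N_x}$, $\|\mathbf{v}\|_{L^\infty(0,T;L^\infty(\Omega))}=\max_{t\in[0,T]}\|\mathbf{v}(t)\|_\infty$, with $\|\cdot\|_\infty$ the maximum norm. *)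

(* Defs.v *)
From HB Require Import structures.
From mathcomp Require Import all_boot all_order all_algebra.
From mathcomp Require Import all_classical all_reals all_analysis.

Set Implicit Arguments.
Unset Strict Implicit.
Unset Printing Implicit Defensive.

Import Order.TTheory GRing.Theory Num.Theory.
Import numFieldNormedType.Exports.

Local Open Scope classical_set_scope.
Local Open Scope ring_scope.

(* The tridiagonal matrix B; the two exceptional entries, (1, 2) and           *)
(* (Nx, Nx - 1) in 1-based numbering, come from the ghost-point treatment of   *)
(* the homogeneous Neumann conditions. Meaningful for 2 <= Nx.                 *)
Definition neumann_stencil (R : realType) (Nx : nat) : 'M[R]_Nx :=
  \matrix_(i < Nx, j < Nx)
    (if i == j then - 2
     else if ((i == 0 :> nat) && (j == 1 :> nat))
             || ((i == Nx.-1 :> nat) && (j == Nx.-2 :> nat)) then 2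
     else if (j == i.+1 :> nat) || (i == j.+1 :> nat) then 1
     else 0).

Definition neumann_laplacian (R : realType) (Nx : nat) (h : R) : 'M[R]_Nx :=
  (h ^+ 2)^-1 *: neumann_stencil R Nx.

(* lambda_(p + 1) in 1-based numbering *)
Definition laplacian_eigenvalue (R : realType) (Nx : nat) (h : R)
    (p : 'I_Nx) : R :=
  2 / h ^+ 2 * (cos (p%:R * pi / (Nx.-1)%:R) - 1).

Definition bilaplacian_spectrum (R : realType) (Nx : nat) (h : R) : 'M[R]_Nx :=
  diag_mx (\row_(p < Nx) laplacian_eigenvalue h p ^+ 2).

(* Classical solution of v' + A v = 0 on ]0, T], continuous on [0, T] (which   *)
(* ties v 0 to the values at positive times). Only the values of v on [0, T]   *)
(* matter: the difference quotient is taken within [0, T], so the derivative   *)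
(* at T is the left derivative.                                                *)
Definition linear_ode_solution (R : realType) (Nx : nat) (A : 'M[R]_Nx)
    (T : R) (v : R -> 'cV[R]_Nx) : Prop :=
  {within `[0, T], continuous v} /\
  forall t : R, 0 < t <= T ->
    (fun s : R => (s - t)^-1 *: (v s - v t)) @ within `[0, T] t^'
      --> - (A *m v t).

(* On 'cV[R]_Nx the norm `| _ | is the maximum norm. The supremum over the     *)
(* closed interval is taken in \bar R so as to be meaningful for every v; it   *)
(* is the maximum as soon as v is continuous (norm_Linf_max below).            *)
Definition norm_Linf (R : realType) (Nx : nat) (T : R) (v : R -> 'cV[R]_Nx)
    : \bar R :=
  ereal_sup [set (`|v t|)%:E | t in `[0, T]].

Lemma norm_Linf_max (R : realType) (Nx : nat) (T : R) (v : R -> 'cV[R]_Nx) :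
  0 <= T -> {within `[0, T], continuous v} ->
  exists2 t : R, t \in `[0, T] & norm_Linf T v = (`|v t|)%:E.
Proof.
move=> T0 vc.
have nvc : {within `[0, T], continuous (fun t => `|v t|)}.
  by move=> t; apply: cvg_norm; exact: vc.
have [c cI cmax] := EVT_max T0 nvc.
exists c => //; apply/eqP; rewrite eq_le; apply/andP; split.
  by apply: ge_ereal_sup => _ [t tI <-]; rewrite lee_fin; exact: cmax.
by apply: ereal_sup_ubound; exists c.
Qed.

(* Main.v *)
Require Import Defs.
From HB Require Import structures.
From mathcomp Require Import all_boot all_order all_algebra.
From mathcomp Require Import all_classical all_reals all_analysis.
From mathcomp Require Import lra.

Import Order.TTheory GRing.Theory Num.Theory.
Import numFieldNormedType.Exports.

Local Open Scope classical_set_scope.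
Local Open Scope ring_scope.

(** For k >= 1 the error e^k = u^k - u solves the same equation as u^k, and
    P^-1 A = D P^-1, so each entry of w^k = P^-1 e^k is a scalar mode with a
    decay rate d >= 0, namely a squared eigenvalue of the discrete Laplacian.
    The square of a mode has derivative -2 d (mode)^2 <= 0, so that
    |w^k(t)| <= |w^k(0)| on [0, T] in the maximum norm
    ([linear_ode_mode_le], [diagonalized_flow_norm_le]).

    The initial condition reads w^k(0) = alpha (w^k(T) - w^(k-1)(T)). It is
    implicit in w^k, but the decay bounds |w^k(T)| by |w^k(0)|, which can then be
    absorbed in the left-hand side since |alpha| < 1:
      |w^k(t)| <= |w^k(0)| <= |alpha| / (1 - |alpha|) |w^(k-1)(T)|.
    Induction on k ends at |w^0(T)|, which is at most the supremum norm of w^0,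
    finite or not. *)

Lemma linear_ode_solutionB (R : realType) (n : nat) (A : 'M[R]_n) (T : R)
    (v w : R -> 'cV[R]_n) :
  linear_ode_solution A T v -> linear_ode_solution A T w ->
  linear_ode_solution A T (fun t => v t - w t).
Proof.
move=> [cv dv] [cw dw]; split.
  by move=> t; apply: cvgB; [exact: cv|exact: cw].
move=> t tT.
have -> : - (A *m (v t - w t)) = - (A *m v t) - - (A *m w t).
  by rewrite mulmxBr opprD.
rewrite [X in X @ _](_ : _ = fun s : R =>
    (s - t)^-1 *: (v s - v t) - (s - t)^-1 *: (w s - w t)); last first.
  apply/funext => s; rewrite -scalerBr; congr (_ *: _).
  by rewrite [in LHS]opprD [LHS]addrACA -opprD.
exact: cvgB (dv t tT) (dw t tT).
Qed.

(** A linear functional carries both the continuity and the difference quotients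
    of a vector-valued solution over to a scalar one. *)
Lemma mulmx_row_continuous (R : realType) (n : nat) (l : 'rV[R]_n) :
  continuous (fun x : 'cV[R]_n => (l *m x) 0 0).
Proof.
rewrite (_ : (fun x => _) = fun x : 'cV[R]_n => \sum_j l 0 j * x j 0).
  apply: continuous_big => [|j _ x]; first exact: add_continuous.
  by apply: cvgMl_tmp; [exact: nbhs_filter|exact: coord_continuous].
by apply/funext => x; rewrite mxE.
Qed.

(** At a point interior to [I], approaching within [I] is no restriction; the
    change of variable s = h + t then turns the difference quotient at t into the
    one, in h, which defines the derivative. *)
Lemma is_derive_quotient (R : realType) (f : R -> R) (I : set R) (t l : R) :
  nbhs t I ->
  (fun s => (s - t)^-1 * (f s - f t)) @ within I t^' --> l ->
  is_derive t 1 f l.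
Proof.
move=> It flim.
have shift0 : (fun h : R => h + t) @ 0^' --> within I t^'.
  move=> S; rewrite /within /= => /nbhs_ballP[e /= e0 eS].
  case/nbhs_ballP: It => d /= d0 dI.
  apply/nbhs_ballP; exists (Num.min e d); first by rewrite /= lt_min e0.
  move=> h /=; rewrite /ball /= sub0r normrN lt_min => /andP[he hd] h0.
  have ht : t - (h + t) = - h by rewrite opprD addrCA subrr addr0.
  apply: eS.
  - by rewrite /ball /= ht normrN.
  - by rewrite -subr_eq0 addrK.
  - by apply: dI; rewrite /ball /= ht normrN.
have dlim :
    (fun h => h^-1 *: ((f \o shift t) (h *: (1 : R)) - f t)) @ 0^' --> l.
  rewrite [X in X @ _](_ : _ =
      (fun s => (s - t)^-1 * (f s - f t)) \o +%R^~ t).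
    exact: cvg_comp shift0 flim.
  by apply/funext => h /=; rewrite addrK [h *: 1]mulr1.
apply: DeriveDef; first by apply/cvg_ex; exists l.
exact: cvg_lim dlim.
Qed.

(** A left eigenvector [l] decouples the scalar f = l v from the system:
    f' = - d f. Hence (f^2)' = - 2 d f^2 <= 0 and |f| is nonincreasing. *)
Lemma linear_ode_mode_le (R : realType) (n : nat) (A : 'M[R]_n) (T : R)
    (v : R -> 'cV[R]_n) (l : 'rV[R]_n) (d : R) :
  linear_ode_solution A T v -> l *m A = d *: l -> 0 <= d ->
  {in `[0, T], forall t, `|(l *m v t) 0 0| <= `|(l *m v 0) 0 0|}.
Proof.
move=> [cv dv] lA d0 t tT.
pose f (s : R) : R := (l *m v s) 0 0.
have cf : {within `[0, T], continuous f}.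
  by move=> s; exact: cvg_comp (cv s) (mulmx_row_continuous _ _ l (v s)).
have df s : s \in `]0, T[ -> is_derive s 1 f (- (d * f s)).
  move=> sI; have /andP[s0 sT] : 0 < s < T by rewrite in_itv in sI.
  apply: (@is_derive_quotient _ _ `[0, T]).
    apply: filterS (near_in_itvoo sI) => r.
    by rewrite /= !in_itv /= => /andP[/ltW-> /ltW->].
  have -> : - (d * f s) = (l *m - (A *m v s)) 0 0.
    by rewrite mulmxN mulmxA lA -scalemxAl [RHS]mxE [in RHS]mxE.
  rewrite [X in X @ _](_ : _ = fun r : R =>
      (l *m ((r - s)^-1 *: (v r - v s))) 0 0).
    have sI' : 0 < s <= T by rewrite s0 ltW.
    exact: cvg_comp (dv s sI') (mulmx_row_continuous _ _ l _).
  by apply/funext => r; rewrite -scalemxAr mulmxBr !mxE /f !mxE.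
have df2 s : s \in `]0, T[ -> is_derive s 1 (f ^+ 2) (- (2 * d * f s ^+ 2)).
  move=> sT; have ? := df s sT.
  apply: is_derive_eq; rewrite /GRing.scale /= expr1 expr2; lra.
have cf2 : {within `[0, T], continuous (f ^+ 2)}.
  by rewrite expr2 => s; apply: cvgM; exact: cf.
rewrite -ler_sqr ?nnegrE // !real_normK ?num_real //.
have /andP[t0 tT'] : 0 <= t <= T by rewrite in_itv in tT.
apply: (@ler0_derive1_le_cc _ (f ^+ 2) 0 T _ _ cf2) => //.
- by move=> s sT; have [] := df2 s sT.
- move=> s sT; have ? := df2 s sT.
  by rewrite derive1E derive_val oppr_le0 mulr_ge0 ?sqr_ge0 ?mulr_ge0.
- by rewrite in_itv /= lexx (le_trans t0).
Qed.

Lemma mx_norm_leP (R : realType) (m n : nat) (x : 'M[R]_(m, n)) (c : R) :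
  0 <= c -> reflect (forall i j, `|x i j| <= c) (`|x| <= c).
Proof.
move=> c0; rewrite [`|x|]mx_normrE; apply: (iffP idP).
  by move=> /bigmax_leP[_ xc] i j; exact: xc (i, j) _.
by move=> xc; apply/bigmax_leP; split=> // ij _; exact: xc.
Qed.

(** The rows of P^-1 are left eigenvectors of A, and in the eigenbasis the maximum
    norm is taken mode by mode. *)
Lemma diagonalized_flow_norm_le (R : realType) (n : nat) (A P : 'M[R]_n)
    (d : 'rV[R]_n) (T : R) (v : R -> 'cV[R]_n) :
  P \in unitmx -> A = P *m diag_mx d *m invmx P -> (forall i, 0 <= d 0 i) ->
  linear_ode_solution A T v ->
  {in `[0, T], forall t, `|invmx P *m v t| <= `|invmx P *m v 0|}.
Proof.
move=> Pu AE d0 vsol t tT.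
have PA : invmx P *m A = diag_mx d *m invmx P by rewrite AE -!mulmxA mulKmx.
have rowE s i j : (invmx P *m v s) i j = (row i (invmx P) *m v s) 0 0.
  by rewrite -row_mul [RHS]mxE (ord1 j).
apply/mx_norm_leP => // i j.
have : `|(invmx P *m v 0) i j| <= `|invmx P *m v 0|.
  exact: (elimT (mx_norm_leP _ _ _ _ _ (normr_ge0 _)) (lexx _)).
apply: le_trans; rewrite !rowE.
apply: (@linear_ode_mode_le _ _ A T v _ (d 0 i)) => //.
by rewrite -row_mul PA mul_diag_mx; apply/rowP => k; rewrite !mxE.
Qed.

(** The unknown [x] bounded partly by itself, as in the implicit initial condition
    of an iterate, is absorbed on the left because [a < 1]. *)
Lemma le_absorb_self (R : realFieldType) (a x y : R) :
  a < 1 -> x <= a * (x + y) -> x <= a / (1 - a) * y.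
Proof.
move=> a1 xle; rewrite mulrAC ler_pdivlMr ?subr_gt0 //; lra.
Qed.

Lemma norm_Linf_ge (R : realType) (n : nat) (T t : R) (v : R -> 'cV[R]_n) :
  t \in `[0, T] -> ((`|v t|)%:E <= norm_Linf T v)%E.
Proof. by move=> tT; apply: ereal_sup_ubound; exists t. Qed.

Theorem theorem2p3 (R : realType) (Nx : nat) (h T alpha : R)
    (A P D : 'M[R]_Nx) (u0 : 'cV[R]_Nx)
    (u : R -> 'cV[R]_Nx) (uk : nat -> R -> 'cV[R]_Nx)
    (hNx : (2 <= Nx)%N) (hh : 0 < h) (hT : 0 < T) (halpha : `|alpha| < 1 / 2)
    (hA : A = neumann_laplacian Nx h ^+ 2)
    (hD : D = bilaplacian_spectrum Nx h)
    (hP : P \in unitmx) (hAPD : A = P *m D *m invmx P)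
    (hu : linear_ode_solution A T u) (hu0 : u 0 = u0)
    (huk : forall k : nat, (1 <= k)%N -> linear_ode_solution A T (uk k))
    (huk0 : forall k : nat, (1 <= k)%N ->
      uk k 0 = alpha *: uk k T - alpha *: uk k.-1 T + u0) :
  forall k : nat, (1 <= k)%N ->
    (norm_Linf T (fun t : R => (invmx P *m (uk k t - u t))%R)
     <= ((`|alpha| / (1 - `|alpha|)) ^+ k)%:E
        * norm_Linf T (fun t : R => (invmx P *m (uk 0%N t - u t))%R))%E.
Proof.
pose w k t := invmx P *m (uk k t - u t).
pose rho := `|alpha| / (1 - `|alpha|).
have alpha1 : `|alpha| < 1 by lra.
have rho_ge0 : 0 <= rho by rewrite divr_ge0 // subr_ge0 ltW.
have decay k t : (1 <= k)%N -> t \in `[0, T] -> `|w k t| <= `|w k 0|.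
  move=> k1; move: t.
  apply: (@diagonalized_flow_norm_le _ _ A P
    (\row_p laplacian_eigenvalue h p ^+ 2)) => //.
  - by rewrite hAPD hD.
  - by move=> i; rewrite mxE sqr_ge0.
  - exact: linear_ode_solutionB (huk k k1) hu.
have TI : T \in `[0, T] by rewrite in_itv /= lexx ltW.
have jump k : w k.+1 0 = alpha *: (w k.+1 T - w k T).
  rewrite /w -mulmxBr scalemxAr huk0 // hu0 addrK /= -scalerBr.
  by rewrite opprB addrA subrK.
have step k t : t \in `[0, T] -> `|w k.+1 t| <= rho * `|w k T|.
  move=> tI; apply: (le_trans (decay _ _ _ tI)) => //.
  apply: le_absorb_self => //.
  (* |w^(k+1)(T)|, on the right, is at most |w^(k+1)(0)|: the bound is in terms of
     its own left-hand side *)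
  rewrite {1}jump normrZ ler_wpM2l // (le_trans (ler_normB _ _)) // lerD2r.
  exact: decay.
have iter k t : t \in `[0, T] -> `|w k.+1 t| <= rho ^+ k.+1 * `|w 0%N T|.
  elim: k t => [|k IHk] t tI; first by rewrite expr1 step.
  by rewrite exprS -mulrA (le_trans (step _ _ tI)) // ler_wpM2l // IHk.
case=> // k _; apply: ge_ereal_sup => _ [t tI <-].
apply: (@le_trans _ _ (rho ^+ k.+1 * `|w 0%N T|)%:E).
  by rewrite lee_fin; exact: iter.
rewrite EFinM lee_wpmul2l ?lee_fin ?exprn_ge0 //.
exact: (@norm_Linf_ge _ _ T T (w 0%N)).
Qed.
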